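(* Let $s\geq 2$, $r\geq 1$ and $n\geq 3r^2(s-1)$ be integers. If $\mathcal{H}$ is an $r$-uniform hypergraph on $n$ vertices with $\sigma_r(\mathcal{H})>r\left(\binom{n-1}{r-1}-\binom{n-s}{r-1}\right)$, then $\mathcal{H}$ contains $s$ pairwise disjoint edges.
   Context: An $r$-uniform hypergraph on vertex set $V$ with $|V|=n$ is a family of $r$-subsets of $V$ (its edges). The degree $\deg(v)$ of a vertex is the number of edges containing it; for an $r$-set $S$, $\deg(S)=\sum_{v\in S}\deg(v)$. The Ore-degree $\sigma_r(\mathcal{H})$ is the minimum of $\deg(S)$ over all $r$-subsets $S\subseteq V$ that are not edges of $\mathcal{H}$. *)

(* Defs.v *)
From mathcomp Require Export all_boot all_order all_algebra.
From mathcomp Require Export constructive_ereal.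

Set Implicit Arguments.
Unset Strict Implicit.
Unset Printing Implicit Defensive.

Definition uniform (V : finType) (r : nat) (H : {set {set V}}) : Prop :=
  forall e : {set V}, e \in H -> #|e| = r.

Definition degree (V : finType) (H : {set {set V}}) (v : V) : nat :=
  #|[set e in H | v \in e]|.

Definition set_degree (V : finType) (H : {set {set V}}) (S : {set V}) : nat :=
  \sum_(v in S) degree H v.

(* The minimum is taken in the extended integers, so that it is +oo when every
   r-subset of V is an edge (minimum over the empty family). *)
Definition ore_degree (V : finType) (r : nat) (H : {set {set V}}) : \bar int :=
  \big[Order.min/+oo%E]_(S : {set V} | (#|S| == r) && (S \notin H))
    ((set_degree H S)%:Z)%:E.

(* Main.v *)
Require Import Defs.
From mathcomp Require Import fingroup perm zify ring lra.
Import Order.TTheory GRing.Theory Num.Theory.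

Set Implicit Arguments.
Unset Strict Implicit.
Unset Printing Implicit Defensive.

(** Induction on [s], following Huang and Zhao.  Put
    [D = 'C(n - 1, r - 1) - 'C(n - s, r - 1)] and suppose that there is no
    matching of size [s].  Deleting a vertex [v] keeps the Ore condition for
    [s - 1], and a matching of size [s - 1] extends by an edge at [v] if [v] has
    degree above [r * D]; hence all degrees are at most [r * D].  If [s] vertices
    had degree above [2 * D], their links outside these vertices would have more
    than [D] members each, and the rainbow matching theorem of Huang, Loh and
    Sudakov would give a matching; hence at most [s - 1] degrees exceed [2 * D].
    All edges meet the at most [r * (s - 1)] vertices of a maximum matching, so
    that [#|H| <= 3 * r * (s - 1) * D].  On the other hand the Ore condition
    forces the average degree above [D], that is [r * #|H| > n * D], which
    contradicts [n >= 3 * r ^ 2 * (s - 1)]. *)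

(** * Rainbow matchings *)

Definition draws (V : finType) (U : {set V}) (k : nat) : {set {set V}} :=
  [set A : {set V} | A \subset U & #|A| == k].

Lemma in_draws (V : finType) (U A : {set V}) k :
  (A \in draws U k) = (A \subset U) && (#|A| == k).
Proof. by rewrite inE. Qed.

Lemma card_draws_setD (V : finType) (U e : {set V}) j k :
  e \in draws U j -> #|draws (U :\: e) k| = 'C(#|U| - j, k).
Proof.
rewrite in_draws => /andP[sub /eqP card_e].
by rewrite cards_draws cardsD (setIidPr sub) card_e.
Qed.

(** Double counting of the disjoint pairs [(e, f)] with [f] outside [F]: each such [f] leaves
    ['C(#|U| - k, j)] choices of [e]. *)
Lemma sum_draws_setD (V : finType) (U : {set V}) (F : {set {set V}}) j k :
  \sum_(e in draws U j) #|draws (U :\: e) k :\: F|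
    = #|draws U k :\: F| * 'C(#|U| - k, j).
Proof.
transitivity (\sum_(f in draws U k :\: F) #|draws (U :\: f) j|).
  under eq_bigr do rewrite -sum1_card.
  under [RHS]eq_bigr do rewrite -sum1_card.
  rewrite (exchange_big_dep (mem (draws U k :\: F))) /=; last first.
    by move=> e f _; rewrite !inE subsetD => /and3P[-> /andP[-> _] ->].
  apply: eq_bigr => f; rewrite !inE => /and3P[fF fU fk].
  apply: eq_bigl => e; rewrite !inE !subsetD fF fU fk !andbT disjoint_sym /=.
  by rewrite -!andbA; congr (_ && _); rewrite andbC.
rewrite -sum_nat_const; apply: eq_bigr => f /setDP[fU _].
exact: card_draws_setD fU.
Qed.

Lemma mul_bin_sub (m j k : nat) :
  'C(m, j) * 'C(m - j, k) = 'C(m, k) * 'C(m - k, j).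
Proof.
have := @sum_draws_setD 'I_m [set: 'I_m] set0 j k.
under eq_bigr => e he do rewrite setD0 (card_draws_setD _ he).
by rewrite sum_nat_const setD0 !cards_draws cardsT card_ord.
Qed.

Definition rainbow (V I : finType) (J : {set I}) (F : I -> {set {set V}})
    (e : I -> {set V}) : Prop :=
  {in J, forall i, e i \in F i} /\
  {in J &, forall i j, i != j -> [disjoint e i & e j]}.

Local Open Scope ring_scope.

(* Averaging over the choice of the first set [e] in [F j]: the expected sum of
   the missing densities of the other families inside [U :\: e] does not
   change, so some [e] keeps it below 1. *)
Lemma rainbow_of_missing_density (V I : finType) (k : I -> nat)
    (F : I -> {set {set V}}) (J : {set I}) (U : {set V}) :
  (\sum_(i in J) k i <= #|U|)%N ->
  \sum_(i in J) #|draws U (k i) :\: F i|%:R / 'C(#|U|, k i)%:R < 1 :> rat ->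
  exists2 e, rainbow J F e & forall i, i \in J -> e i \subset U.
Proof.
elim: {J}_.+1 {-2}J (ltnSn #|J|) U => // c IH J cJ U leU small.
have [->|[j jJ]] := set_0Vmem J.
  by exists (fun=> set0); [split=> i|move=> i]; rewrite inE.
have sumJ : (\sum_(i in J) k i = k j + \sum_(i in J :\ j) k i)%N.
  by rewrite (big_setD1 j).
have kU : (k j <= #|U|)%N by lia.
pose w (e : {set V}) : rat := \sum_(i in J :\ j)
  #|draws (U :\: e) (k i) :\: F i|%:R / 'C(#|U| - k j, k i)%:R.
have sumw : \sum_(e in draws U (k j)) w e = 'C(#|U|, k j)%:R *
   \sum_(i in J :\ j) #|draws U (k i) :\: F i|%:R / 'C(#|U|, k i)%:R.
  rewrite exchange_big mulr_sumr; apply: eq_bigr => i iJ.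
  rewrite -mulr_suml -natr_sum sum_draws_setD natrM.
  have ki : (k i + k j <= #|U|)%N.
    by move: leU; rewrite sumJ (big_setD1 i iJ) /=; lia.
  have /(congr1 (fun x : nat => x%:R : rat)) := mul_bin_sub #|U| (k j) (k i).
  rewrite !natrM => E.
  have n1 : 'C(#|U|, k i)%:R != 0 :> rat by rewrite pnatr_eq0 -lt0n bin_gt0; lia.
  have n2 : 'C(#|U| - k j, k i)%:R != 0 :> rat
    by rewrite pnatr_eq0 -lt0n bin_gt0; lia.
  suff frac (a b p q d : rat) : p != 0 -> q != 0 -> d * q = p * b ->
      a * b / q = d * (a / p) by exact: frac.
  move=> p0 q0 dq; have -> : b = d * q / p by rewrite dq mulrC mulKf.
  by field; rewrite p0.
have [e eF we] : exists2 e, e \in draws U (k j) :&: F j & w e < 1.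
  (* If [w e >= 1] for all these [e], averaging bounds the density of [F j] by the missing densities
     of the other families, and the total would be at least 1. *)
  apply/exists_inP; apply: contraLR small; rewrite negb_exists_in -leNgt.
  move=> /forall_inP big.
  have le1 : #|draws U (k j) :&: F j|%:R <= \sum_(e in draws U (k j)) w e.
    rewrite (big_setID (F j)) /= -sum1_card natr_sum.
    apply: le_trans (_ : \sum_(e in draws U (k j) :&: F j) w e <= _).
      by apply: ler_sum => e /big; rewrite -leNgt.
    rewrite lerDl; apply: sumr_ge0 => e _; apply: sumr_ge0 => i _.
    by rewrite divr_ge0 ?ler0n.
  rewrite sumw in le1; rewrite (big_setD1 j) //=.
  have C0 : 0 < 'C(#|U|, k j)%:R :> rat by rewrite ltr0n bin_gt0.
  have CE : 'C(#|U|, k j)%:R = #|draws U (k j) :&: F j|%:R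
      + #|draws U (k j) :\: F j|%:R :> rat.
    by rewrite -natrD cardsID cards_draws.
  rewrite -(ler_pM2l C0) mulr1 mulrDr mulrCA divff ?gt_eqF // mulr1.
  by rewrite {1}CE addrC lerD2l.
have /setIP[eU eFj] := eF.
have cUe : #|U :\: e| = (#|U| - k j)%N.
  by move: eU; rewrite in_draws => /andP[sU /eqP ce]; rewrite cardsD (setIidPr sU) ce.
have [||| f [fF fD] fU] := IH (J :\ j) _ (U :\: e).
- by move: cJ; rewrite (cardsD1 j J) jJ; lia.
- by rewrite cUe; lia.
- by rewrite cUe.
have fe i : i \in J -> i != j -> [disjoint f i & e].
  by move=> iJ ij; have := fU i; rewrite !inE ij iJ subsetD => /(_ isT)/andP[].
exists (fun i => if i == j then e else f i).
  split=> [i iJ|i i' iJ iJ' ii'] /=.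
    by case: eqVneq => [->//|ij]; apply: fF; rewrite !inE ij.
  case: eqVneq => [ij|ij]; case: eqVneq => [i'j|i'j].
  - by rewrite ij i'j eqxx in ii'.
  - by rewrite disjoint_sym; apply: fe.
  - exact: fe.
  - by apply: fD; rewrite ?inE ?ij ?i'j.
move=> i iJ; case: eqVneq => [_|ij]; first by move: eU; rewrite in_draws => /andP[].
by apply: subset_trans (fU i _) (subsetDl _ _); rewrite !inE ij.
Qed.

Local Close Scope ring_scope.

(** * Shifting one vertex to another *)

Section Shift.

Variables (V : finType) (x z : V).
Implicit Types (e f : {set V}) (F : {set {set V}}).

Definition swap (e : {set V}) : {set V} := tperm x z @: e.

(** The usual compression from [z] to [x], written as a membership test: when just one of [e] and
    [swap e] is in [F], the one through [x] is kept. *)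
Definition shift (F : {set {set V}}) : {set {set V}} :=
  [set e : {set V} | if (z \in e) && (x \notin e) then (e \in F) && (swap e \in F)
           else if (x \in e) && (z \notin e) then (e \in F) || (swap e \in F)
           else e \in F].

Lemma in_swap e y : (y \in swap e) = (tperm x z y \in e).
Proof. by rewrite -{1}[y](tpermK x z) mem_imset //; apply: perm_inj. Qed.

Lemma swapK : involutive swap.
Proof. by move=> e; apply/setP=> y; rewrite !in_swap tpermK. Qed.

Lemma card_swap e : #|swap e| = #|e|.
Proof. by rewrite card_imset //; apply: perm_inj. Qed.

Lemma swap_sub (U e : {set V}) : x \in U -> z \in U -> e \subset U -> swap e \subset U.
Proof.
move=> xU zU /subsetP eU; apply/subsetP=> y; rewrite in_swap => /eU.
by case: tpermP => [->|->|].
Qed.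

Lemma swap_disjoint e f : [disjoint e & f] -> [disjoint swap e & swap f].
Proof.
rewrite -!setI_eq0 => /eqP ef; apply/eqP/setP=> y.
by have /setP/(_ (tperm x z y)) := ef; rewrite !inE !in_swap.
Qed.

Lemma swap_id e : (x \in e) = (z \in e) -> swap e = e.
Proof. by move=> xz; apply/setP=> y; rewrite in_swap; case: tpermP => [->|->|]. Qed.

Lemma swapE e : z \in e -> x \notin e -> swap e = x |: (e :\ z).
Proof.
move=> ze xe; apply/setP=> y; rewrite in_swap !inE; case: tpermP => [->|->|].
- by rewrite eqxx ze.
- by rewrite eqxx orbF (negbTE xe); apply/esym/negbTE; apply: contraNneq xe => <-.
- by move=> /eqP/negbTE-> /eqP/negbTE->.
Qed.

(** Each pair [e], [swap e] keeps its number of members; counting every set together with its swap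
    makes this visible term by term. *)
Lemma card_shift F : #|shift F| = #|F|.
Proof.
have card2 (G : {set {set V}}) : #|G|.*2 = \sum_e ((e \in G) + (swap e \in G)).
  have card1 : #|G| = \sum_e (e \in G).
    by rewrite -sum1_card big_mkcond; apply: eq_bigr => e _; case: ifP.
  rewrite big_split /= -card1 -addnn; congr (_ + _).
  by rewrite card1 (reindex_inj (inv_inj swapK)).
apply: double_inj; rewrite !card2; apply: eq_bigr => e _.
rewrite !inE swapK !in_swap tpermL tpermR.
by case: (x \in e) (z \in e) => [] [] /=; case: (e \in F); case: (swap e \in F).
Qed.

Lemma shift_memP F e : e \in shift F -> e \in F \/ swap e \in F.
Proof.
rewrite inE; case: ifP => _; first by case/andP; left.
by case: ifP => _ => [/orP|]; [|left].
Qed.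

Lemma shift_sub F e : z \in e -> e \in shift F -> e \in F.
Proof. by rewrite inE => ->; rewrite andbF; case: ifP => // _ /andP[]. Qed.

(** If some [e a] is not in [F a], it contains [x] and not [z], so the other sets avoid [x].
    Swapping every set then repairs all of them: a set through [z] survives the shift only if its
    swap is present too, and the remaining ones are fixed. *)
Lemma rainbow_shift (I : finType) (F : I -> {set {set V}}) (e : I -> {set V}) :
  rainbow setT (fun i => shift (F i)) e -> exists h, rainbow setT F h.
Proof.
case=> eF eD.
have [/forallP inF|] := boolP [forall i, e i \in F i].
  by exists e; split=> // i _; apply: inF.
rewrite negb_forall => /existsP[a eaF].
have := eF a (in_setT a); rewrite !inE (negbTE eaF) /=.
case: ifP => // _; case: ifP => // /andP[xa za] sa.
exists (fun i => swap (e i)); split=> [i _|i j iT jT ij]; last exact/swap_disjoint/eD.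
have [->//|ia] := eqVneq i a.
have xi : x \notin e i.
  by apply: contraTN xa => xi; rewrite (disjointFr (eD i a _ _ ia) xi) ?in_setT.
have := eF i (in_setT i); rewrite inE xi andbT (negbTE xi) /=.
have [zi|zi] := boolP (z \in e i); first by case/andP.
by rewrite swap_id // (negbTE xi) (negbTE zi).
Qed.

End Shift.

Lemma exists_injection (A B : finType) (b0 : B) (P : {set A}) (Q : {set B}) :
  #|P| <= #|Q| ->
  exists2 f : A -> B, {in P &, injective f} & forall a, a \in P -> f a \in Q.
Proof.
move=> le; have idx a : a \in P -> index a (enum P) < size (enum Q).
  by move=> aP; rewrite -cardE (leq_trans _ le) // cardE index_mem mem_enum.
exists (fun a => nth b0 (enum Q) (index a (enum P))) => [a a' aP aP' /eqP|a aP].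
  rewrite nth_uniq ?idx ?enum_uniq // => /eqP e.
  by rewrite -[a](nth_index a (s := enum P)) ?mem_enum // e nth_index ?mem_enum.
by rewrite -mem_enum mem_nth ?idx.
Qed.

Lemma disjoint_setU1 (V : finType) (v : V) (A B : {set V}) :
  [disjoint v |: A & B] = (v \notin B) && [disjoint A & B].
Proof. by rewrite -setI_eq0 setIUl setU_eq0 !setI_eq0 disjoints1. Qed.

(* ['C(m - 1, k - 1)], read as 0 when [k = 0]. *)
Definition bin_pred (m k : nat) : nat := if k is k'.+1 then 'C(m.-1, k') else 0.

Lemma mul_bin_pred m k : m * bin_pred m k = k * 'C(m, k).
Proof. by case: k => [|k]; rewrite ?muln0 // mul_bin_diag. Qed.

(** Pascal's rule; the value 0 at [k = 0] is what makes it hold at [k = 1]. *)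
Lemma bin_predS m k :
  0 < m -> 0 < k -> bin_pred m.+1 k = bin_pred m k + bin_pred m k.-1.
Proof. by case: m k => [//|m] [//|[|k]] _ _ /=; rewrite ?bin0 // binS. Qed.

(** * Rainbow matchings in large families *)

Section Rainbow.

Variables (V I : finType).
Implicit Types (F : I -> {set {set V}}) (k : I -> nat) (U : {set V}).

(** Since [k i] sums to [#|U|], the size bounds say that the density of [F i] exceeds
    [(#|I| - 1) * k i / #|U|]. So the densities sum to more than [#|I| - 1], and the missing ones to
    less than 1. *)
Lemma rainbow_tight k F U :
  (forall i, F i \subset draws U (k i)) -> \sum_i k i = #|U| ->
  (forall i, #|I|.-1 * bin_pred #|U| (k i) < #|F i|) ->
  exists e, rainbow setT F e.
Proof.
move=> FU sumk big.
have [||e re _] := @rainbow_of_missing_density V I k F setT U.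
- by under eq_bigl do rewrite inE; rewrite sumk.
- under eq_bigl do rewrite inE.
  have ki i : k i <= #|U| by rewrite -sumk (bigD1 i) //= leq_addr.
  have [I0|[i0 _]] := set_0Vmem [set: I].
    rewrite big1 // => i _; by have := in_setT i; rewrite I0 inE.
  have missing i : (#|draws U (k i) :\: F i|%:R / 'C(#|U|, k i)%:R
      = 1 - #|F i|%:R / 'C(#|U|, k i)%:R :> rat)%R.
    have C0 : ('C(#|U|, k i)%:R != 0 :> rat)%R.
      by rewrite pnatr_eq0 -lt0n bin_gt0.
    rewrite cardsD (setIidPr (FU i)) cards_draws natrB ?mulrBl ?divff //.
    by rewrite -cards_draws subset_leq_card.
  under eq_bigr do rewrite missing.
  have [U0|Upos] := posnP #|U|.
    rewrite big1 // => i _.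
    have k0 : k i = 0 by have := ki i; rewrite U0 leqn0 => /eqP.
    have /subset_leq_card := FU i; rewrite cards_draws k0 bin0.
    have := big i; rewrite k0 muln0 => ? ?.
    by have -> : #|F i| = 1 by lia; rewrite divff ?subrr.
  have U0 : (0 < #|U|%:R :> rat)%R by rewrite ltr0n.
  have dens i : ((#|I|.-1 * k i)%:R / #|U|%:R < #|F i|%:R / 'C(#|U|, k i)%:R :> rat)%R.
    have C0 : (0 < 'C(#|U|, k i)%:R :> rat)%R by rewrite ltr0n bin_gt0.
    rewrite ltr_pdivrMr // mulrAC ltr_pdivlMr // -!natrM ltr_nat.
    rewrite -mulnA -mul_bin_pred mulnCA [X in _ < X]mulnC ltn_pmul2l //; exact: big.
  have lt : (\sum_i ((#|I|.-1 * k i)%:R / #|U|%:R)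
      < \sum_i #|F i|%:R / 'C(#|U|, k i)%:R :> rat)%R.
    rewrite (bigD1 i0) //= [X in (_ < X)%R](bigD1 i0) //=.
    by apply: ltr_leD => //; apply: ler_sum => i _; apply: ltW.
  rewrite sumrB sumr_const -mulr_suml -natr_sum -big_distrr /= sumk natrM in lt *.
  rewrite mulfK ?gt_eqF // in lt.
  have I1 : #|I| = #|I|.-1.+1 by rewrite prednK //; apply/card_gt0P; exists i0.
  rewrite [X in (X - _)%R](_ : _ = #|I|.-1%:R + 1)%R; last by rewrite {1}I1 -natr1.
  lra.
by exists e.
Qed.

(** Says that no shift from [z] to a point of [U] changes [G]: by [swapE], the set [x |: (e :\ z)]
    is [swap x z e]. *)
Definition stable_at U z (G : {set {set V}}) : Prop :=
  forall x e, x \in U -> e \in G -> z \in e -> x \notin e -> x |: (e :\ z) \in G.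

Lemma rainbow_stable k F U z (m := #|U :\ z|) :
  z \in U -> (forall i, F i \subset draws U (k i)) -> \sum_i k i <= m ->
  (forall i, #|I|.-1 * bin_pred #|U| (k i) < #|F i|) ->
  (forall i, stable_at U z (F i)) ->
  (forall k' F', (forall i, F' i \subset draws (U :\ z) (k' i)) ->
    \sum_i k' i <= m -> (forall i, #|I|.-1 * bin_pred m (k' i) < #|F' i|) ->
    exists e, rainbow setT F' e) ->
  exists e, rainbow setT F e.
Proof.
move=> zU FU sumk big st IH.
have cU : #|U| = m.+1 by rewrite (cardsD1 z U) zU.
pose del i := [set e in F i | z \notin e].
pose link i := [set e :\ z | e in [set e in F i | z \in e]].
have card_link i : #|link i| = #|[set e in F i | z \in e]|.
  rewrite card_in_imset // => e e'; rewrite !inE => /andP[_ ze] /andP[_ ze'] E.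
  by rewrite -(setD1K ze) E setD1K.
have cardF i : #|F i| = #|link i| + #|del i|.
  rewrite card_link -(cardsID [set e : {set V} | z \in e] (F i)); congr (_ + _).
    by apply: eq_card => e; rewrite !inE.
  by apply: eq_card => e; rewrite !inE andbC.
pose b i := #|I|.-1 * bin_pred m (k i) < #|del i|.
have FUE i e : e \in F i -> e \subset U /\ #|e| = k i.
  by move=> /(subsetP (FU i)); rewrite in_draws => /andP[? /eqP].
have k_pos i : ~~ b i -> 0 < k i.
  rewrite /b lt0n; apply: contraNneq => k0; rewrite k0 muln0.
  have /card_gt0P[e eF] : 0 < #|F i| by apply: leq_ltn_trans (big i).
  apply/card_gt0P; exists e; rewrite inE eF.
  by have [_] := FUE _ _ eF; rewrite k0 => /cards0_eq->; rewrite inE.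
have ki i : k i <= m by apply: leq_trans sumk; rewrite (bigD1 i) //= leq_addr.
have [|||h [hF hD]] := IH (fun i => if b i then k i else (k i).-1)
    (fun i => if b i then del i else link i).
- move=> i; case: ifP => bi; apply/subsetP=> e.
    rewrite inE => /andP[/FUE[eU ce] ze].
    by rewrite in_draws subsetD1 eU ze ce eqxx.
  case/imsetP=> f; rewrite inE => /andP[/FUE[fU cf] zf] ->.
  by rewrite in_draws setSD // -cf (cardsD1 z f) zf eqxx.
- by apply: leq_trans sumk; apply: leq_sum => i _; case: ifP => // _; apply: leq_pred.
- move=> i; case: ifP => // /negbT bi; move: (big i) (bi) => big_i.
  rewrite /b -leqNgt cardF cU bin_predS ?k_pos // in big_i *; last first.
    exact: leq_trans (k_pos i bi) (ki i).
  rewrite mulnDr in big_i => le_del; rewrite -(ltn_add2l (#|I|.-1 * bin_pred m (k i))).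
  by apply: leq_trans big_i _; rewrite addnC leq_add2r.
pose free := U :\: \bigcup_i h i.
have hU i : h i \subset U :\ z /\ #|h i| = (if b i then k i else (k i).-1).
  have := hF i (in_setT i); case: ifP => _.
    by rewrite inE => /andP[/FUE[eU ce] ze]; rewrite subsetD1 eU ze.
  case/imsetP=> f; rewrite inE => /andP[/FUE[fU cf] zf] ->.
  by split; [apply: setSD | rewrite -cf (cardsD1 z f) zf].
have card_h : #|\bigcup_i h i| <= \sum_i #|h i|.
  apply: (big_ind2 (fun (A : {set V}) n => #|A| <= n)) => [|A a B c Aa Bc|//].
    by rewrite cards0.
  by rewrite (leq_trans (leq_card_setU A B).1) ?leq_add.
(* One vertex must be added for each link. In all [\sum_i k i <= m < #|U|] vertices are used, so
   there are enough free ones. *)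
have count : \sum_i #|h i| + #|[set i | ~~ b i]| = \sum_i k i.
  rewrite -sum1dep_card [X in _ + X]big_mkcond -big_split /=; apply: eq_bigr => i _.
  have [_ ->] := hU i; case: ifP => [_|/negbT bi] /=; first by rewrite addn0.
  by rewrite addn1 prednK ?k_pos.
have [|g g_inj g_free] := @exists_injection I V z [set i | ~~ b i] free.
  have : #|U| <= #|free| + #|\bigcup_i h i|.
    rewrite -(cardsID (\bigcup_i h i) U) addnC leq_add2l.
    exact/subset_leq_card/subsetIr.
  by lia.
have g_h i j : ~~ b i -> g i \notin h j.
  move=> bi; have := g_free i; rewrite !inE => /(_ bi)/andP[gh _].
  by apply: contra gh => gj; apply/bigcupP; exists j.
exists (fun i => if b i then h i else g i |: h i); split=> [i _|i j _ _ ij].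
  have := hF i (in_setT i); case: ifP => [_|/negbT bi]; first by rewrite inE => /andP[].
  case/imsetP=> f; rewrite inE => /andP[fF zf] hE.
  (* [z] itself is free, and adding it gives back the member from which the link was taken. *)
  have [gz|gz] := eqVneq (g i) z; first by rewrite gz hE setD1K.
  rewrite hE; apply: st => //.
    by have := g_free i; rewrite !inE => /(_ bi)/andP[].
  by have := g_h i i bi; rewrite hE !inE gz.
have dh := hD i j (in_setT i) (in_setT j) ij.
case: ifP => [_|/negbT bi]; case: ifP => [_|/negbT bj] //.
- by rewrite disjoint_sym disjoint_setU1 g_h // disjoint_sym.
- by rewrite disjoint_setU1 g_h.
- rewrite disjoint_setU1 !inE negb_or g_h // andbT [X in _ && X]disjoint_sym.
  rewrite disjoint_setU1 g_h // disjoint_sym dh !andbT.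
  by apply: contra_neq ij; apply: g_inj; rewrite inE.
Qed.

(* Huang, Loh and Sudakov.  Shifting towards [U :\ z] makes all the families
   stable at [z]; each of them then has a large link or a large deletion at [z],
   and the vertices missing from the links can be chosen freely afterwards. *)
Lemma rainbow_matching k F U :
  (forall i, F i \subset draws U (k i)) -> \sum_i k i <= #|U| ->
  (forall i, #|I|.-1 * bin_pred #|U| (k i) < #|F i|) ->
  exists e, rainbow setT F e.
Proof.
move: {2}#|U| (erefl #|U|) => m; elim: m U k F => [|m IH] U k F cU FU.
  rewrite cU leqn0 => /eqP sumk big.
  by apply: rainbow_tight FU _ _; rewrite cU.
rewrite leq_eqVlt => /orP[/eqP sumk|]; first exact: rainbow_tight FU sumk.
rewrite cU ltnS => sumk big.
have /card_gt0P[z zU] : 0 < #|U| by rewrite cU.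
have cUz : #|U :\ z| = m by move: cU; rewrite (cardsD1 z U) zU => -[].
(* A shift that changes some family strictly lowers this number of incidences with [z], so shifting
   stops; without a [bad] triple every family is stable at [z]. *)
pose weight (G : I -> {set {set V}}) := \sum_i #|[set e in G i | z \in e]|.
elim: {F}_.+1 {-2}F (ltnSn (weight F)) FU big => // c IHc F wF FU big.
pose bad (w : V * I * {set V}) := [&& w.1.1 \in U, w.2 \in F w.1.2, z \in w.2,
  w.1.1 \notin w.2 & swap w.1.1 z w.2 \notin F w.1.2].
have [/existsP[[[x i] e] /and5P[/= xU eF ze xe sF]]|good] := boolP [exists w, bad w].
  have [|||h] := IHc (fun j => shift x z (F j)); last exact: rainbow_shift.
  - rewrite -ltnS; apply: leq_trans wF; rewrite ltnS /weight (bigD1 i) //= [X in _ < X](bigD1 i) //=.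
    rewrite -addSn leq_add //; last first.
      apply: leq_sum => j _; apply: subset_leq_card; apply/subsetP=> f.
      by case/setIdP=> fF zf; rewrite inE (shift_sub zf fF).
    apply: proper_card; apply/properP; split.
      by apply/subsetP=> f /setIdP[fF zf]; rewrite inE (shift_sub zf fF).
    by exists e; rewrite !inE ?eF ?ze //= xe (negbTE sF).
  - move=> j; apply/subsetP=> f /shift_memP[/(subsetP (FU j))//|].
    move/(subsetP (FU j)); rewrite !in_draws card_swap => /andP[sU ->].
    by rewrite -[f](swapK x z) swap_sub.
  - by move=> j; rewrite card_shift.
apply: (rainbow_stable zU FU) => //; rewrite ?cUz //; first by move=> i; rewrite cU.
  move=> i x e xU eF ze xe; rewrite -swapE //.
  apply: contraNT good => sF; apply/existsP; exists (x, i, e).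
  by rewrite /bad /= xU eF ze xe.
by move=> k' F' FU' sumk' big'; apply: IH FU' _ _; rewrite cUz.
Qed.

End Rainbow.

(** * Degrees and matchings *)

(** For [x <= N], the number of [k]-subsets of an [N]-set that meet a given [x]-subset. *)
Definition bin_gap (N k x : nat) : nat := 'C(N, k) - 'C(N - x, k).

Lemma bin_convex p q t k :
  p <= q -> 'C(p + t, k) + 'C(q, k) <= 'C(q + t, k) + 'C(p, k).
Proof.
move=> pq; elim: t => [|t IH]; first by rewrite !addn0 addnC.
case: k IH => [|k] IH; rewrite ?bin0 // !addnS !binS.
have : 'C(p + t, k) <= 'C(q + t, k) by rewrite leq_bin2l ?leq_add2r.
by lia.
Qed.

(** Cut the range from [N - a * t] to [N] into [a] blocks of length [t]; by convexity the top block
    has the largest increment. *)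
Lemma bin_gap_mul N k a t : a * t <= N -> bin_gap N k (a * t) <= a * bin_gap N k t.
Proof.
elim: a => [|a IH]; first by rewrite !mul0n /bin_gap subn0 subnn.
rewrite !mulSn => le; have {IH} := IH ltac:(lia).
move: (a * t) (a * bin_gap N k t) le => y z le; rewrite /bin_gap.
have := @bin_convex (N - (t + y)) (N - t) t k ltac:(lia).
rewrite [in 'C(N - (t + y) + t, k)](_ : N - (t + y) + t = N - y); last lia.
rewrite [in 'C(N - t + t, k)](_ : N - t + t = N); last lia.
have := @leq_bin2l (N - y) N k ltac:(lia).
have := @leq_bin2l (N - t) N k ltac:(lia).
lia.
Qed.

Lemma leq_bin_gap N k x y : x <= y -> bin_gap N k x <= bin_gap N k y.
Proof. by move=> xy; rewrite leq_sub2l // leq_bin2l // leq_sub2l. Qed.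

(** Deleting a vertex and lowering [t] by 1 lowers the Ore threshold per vertex by exactly the bound
    on the degree that a vertex can lose. *)
Lemma bin_gapS N k t :
  bin_gap N k t.+1 = bin_gap N.-1 k t + bin_gap N k 1.
Proof.
rewrite /bin_gap (_ : N - t.+1 = N.-1 - t) ?subn1; last lia.
have := @leq_bin2l (N.-1 - t) N.-1 k ltac:(lia).
have := @leq_bin2l N.-1 N k ltac:(lia).
lia.
Qed.

(** By Pascal's rule each of the [t] steps up from [N - t] adds at least [bin_pred (N - t) k]. This
    links degree bounds to the threshold of [rainbow_matching]. *)
Lemma bin_gap_ge N k t : t <= N -> t * bin_pred (N - t) k <= bin_gap N k t.
Proof.
move=> tN; rewrite /bin_gap leq_subRL ?leq_bin2l ?leq_subr //.
rewrite -[X in _ <= 'C(X, _)](subnK tN); move: (N - t) => q {tN}.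
elim: t => [|t IH]; first by rewrite mul0n !addn0.
case: k IH => [|k] IH; first by rewrite muln0 !bin0.
rewrite addnS binS mulSn addnCA addnC leq_add //.
by rewrite /= leq_bin2l // (leq_trans (leq_pred _)) // leq_addr.
Qed.

Lemma exists_draw (V : finType) (U : {set V}) k :
  k <= #|U| -> exists A, A \in draws U k.
Proof. by move=> kU; apply/card_gt0P; rewrite cards_draws bin_gt0. Qed.

Lemma card_draws_mem (V : finType) (U : {set V}) r v :
  0 < r -> v \in U ->
  #|[set e in draws U r | v \in e]| = 'C(#|U|.-1, r.-1).
Proof.
move=> r0 vU; have -> : #|U|.-1 = #|U :\ v| by rewrite (cardsD1 v U) vU.
rewrite -cards_draws -/(draws (U :\ v) r.-1).
have inj : {in [set e in draws U r | v \in e] &, injective (fun e => e :\ v)}.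
  by move=> e f /setIdP[_ ve] /setIdP[_ vf] E; rewrite -(setD1K ve) E setD1K.
rewrite -(card_in_imset inj); apply: eq_card => f; apply/imsetP/idP.
  case=> e; rewrite !inE => /andP[/andP[eU /eqP ce] ve] ->.
  by rewrite setSD // -ce (cardsD1 v e) ve /=.
rewrite in_draws subsetD1 => /andP[/andP[fU vf] /eqP cf].
exists (v |: f); last by rewrite setU1K.
by rewrite !inE eqxx /= subUset sub1set vU fU cardsU1 vf cf add1n prednK ?eqxx.
Qed.

(** Among the [r]-subsets of [U] through [v], those that avoid [X] are the [r]-subsets of [U :\: X]
    through [v]; subtract their number. *)
Lemma card_meeting (V : finType) (U X : {set V}) (H : {set {set V}}) r v :
  0 < r -> H \subset draws U r -> v \in U -> X \subset U :\ v ->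
  #|[set e in H | (v \in e) && ~~ [disjoint e & X]]|
    <= bin_gap #|U|.-1 r.-1 #|X|.
Proof.
move=> r0 HU vU; rewrite subsetD1 => /andP[XU vX].
have cUX : (#|U|.-1 - #|X|) = #|U :\: X|.-1 by rewrite cardsD (setIidPr XU); lia.
rewrite /bin_gap cUX -(card_draws_mem r0 vU) -(@card_draws_mem _ (U :\: X) r v) //;
  last by rewrite inE vX.
have sub : [set e in draws (U :\: X) r | v \in e]
    \subset [set e in draws U r | v \in e].
  apply/subsetP=> e; rewrite !inE subsetD => /andP[/andP[/andP[-> _] ->] ->] //.
rewrite -[Y in _ - #|pred_of_set Y|](setIidPr sub) -cardsD; apply: subset_leq_card.
apply/subsetP=> e; rewrite inE => /and3P[/(subsetP HU) eU ve eX].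
by rewrite in_setD !inE subsetD (negbTE eX) andbF /= ve andbT; rewrite in_draws in eU.
Qed.

Definition has_matching (V : finType) (H : {set {set V}}) (s : nat) : bool :=
  [exists M : {set {set V}}, [&& M \subset H, #|M| == s & trivIset M]].

Lemma has_matchingP (V : finType) (H : {set {set V}}) s :
  reflect (exists M : {set {set V}}, [/\ M \subset H, #|M| = s & trivIset M])
    (has_matching H s).
Proof.
by apply: (iffP existsP) => -[M] => [/and3P[? /eqP ? ?]|[? <- ?]]; exists M => //;
  apply/and3P.
Qed.

Lemma has_matching_leq (V : finType) (H M : {set {set V}}) s :
  M \subset H -> trivIset M -> s <= #|M| -> has_matching H s.
Proof.
move=> MH tM /exists_draw[A]; rewrite in_draws => /andP[AM /eqP cA].
apply/has_matchingP; exists A; split=> //; first exact: subset_trans MH.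
exact: trivIsetS tM.
Qed.

(** * Degree sums and matchings in a uniform hypergraph *)

Section Uniform.

Variables (V : finType) (U : {set V}) (r : nat) (H : {set {set V}}).
Hypotheses (r_gt0 : 0 < r) (HU : H \subset draws U r).

Lemma edgeP e : e \in H -> e \subset U /\ #|e| = r.
Proof. by move=> /(subsetP HU); rewrite in_draws => /andP[? /eqP]. Qed.

Lemma extend_matching (M : {set {set V}}) e :
  M \subset H -> trivIset M -> e \in H -> [disjoint e & cover M] ->
  has_matching H #|M|.+1.
Proof.
move=> MH tM eH de; have [|||tM' eM] := @trivIsetU1 _ e M.
- move=> f fM; apply: disjointWr de; exact: bigcup_sup.
- exact: tM.
(* Edges are nonempty as [r > 0], so an edge disjoint from [cover M] is not already in [M]. *)
- apply/negP=> /(subsetP MH)/edgeP[_]; rewrite cards0; lia.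
apply: has_matching_leq tM' _; first by rewrite subUset sub1set eH.
by rewrite cardsU1 eM.
Qed.

Lemma card_cover_edges (M : {set {set V}}) :
  M \subset H -> #|cover M| <= r * #|M|.
Proof.
move=> MH; apply: leq_trans (leq_card_cover M).1 _.
rewrite (eq_bigr (fun=> r)); first by rewrite sum_nat_const mulnC.
by move=> e /(subsetP MH)/edgeP[].
Qed.

Lemma cover_sub (M : {set {set V}}) : M \subset H -> cover M \subset U.
Proof. by move=> MH; apply/bigcupsP=> e /(subsetP MH)/edgeP[]. Qed.

Lemma sum_edges (P : {set {set V}}) (d : V -> nat) : P \subset draws U r ->
  \sum_(S in P) \sum_(v in S) d v = \sum_(v in U) d v * degree P v.
Proof.
move=> PU; rewrite (exchange_big_dep (mem U)) /=; last first.
  by move=> S v /(subsetP PU); rewrite in_draws => /andP[/subsetP SU _] /SU.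
apply: eq_bigr => v _; rewrite mulnC -sum_nat_const /degree.
by apply: eq_bigl => S; rewrite inE.
Qed.

Lemma sum_degree : \sum_(v in U) degree H v = r * #|H|.
Proof.
have := sum_edges (fun=> 1) HU; under [RHS]eq_bigr do rewrite mul1n.
move=> <-; rewrite (eq_bigr (fun=> r)); first by rewrite sum_nat_const mulnC.
by move=> S SH; rewrite sum1_card; have [] := edgeP SH.
Qed.

(** Cauchy-Schwarz, by summing [2 * (d u * d v) <= d u ^ 2 + d v ^ 2] over all pairs. *)
Lemma sqr_sum_leq (d : V -> nat) :
  (\sum_(v in U) d v) ^ 2 <= #|U| * \sum_(v in U) d v ^ 2.
Proof.
rewrite -(leq_pmul2l (isT : 0 < 2)) -mulnn big_distrlr /= big_distrr /=.
have -> : 2 * (#|U| * \sum_(v in U) d v ^ 2)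
    = \sum_(u in U) \sum_(v in U) (d u ^ 2 + d v ^ 2).
  under [RHS]eq_bigr do rewrite big_split /= sum_nat_const.
  by rewrite big_split /= -big_distrr /= sum_nat_const mul2n -addnn.
apply: leq_sum => u _; rewrite big_distrr /=; apply: leq_sum => v _.
exact: nat_Cauchy.
Qed.

(* Edges have an above-average degree sum (Cauchy-Schwarz), hence non-edges a
   below-average one. *)
Lemma ore_average D : ~~ (draws U r \subset H) ->
  (forall S, S \in draws U r -> S \notin H -> r * D < set_degree H S) ->
  #|U| * D < r * #|H|.
Proof.
case/subsetPn=> S0 S0U S0H ore.
have q0 : 0 < #|draws U r :\: H| by apply/card_gt0P; exists S0; rewrite inE S0H.
have cq : #|draws U r :\: H| = 'C(#|U|, r) - #|H|.
  by rewrite cardsD (setIidPr HU) cards_draws.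
have total : \sum_(S in draws U r) set_degree H S = r * #|H| * 'C(#|U|.-1, r.-1).
  rewrite sum_edges // -sum_degree big_distrl /=; apply: eq_bigr => v vU.
  by rewrite -(card_draws_mem r_gt0 vU).
have edges : \sum_(S in H) set_degree H S = \sum_(v in U) degree H v ^ 2.
  by rewrite sum_edges //; apply: eq_bigr => v _; rewrite mulnn.
have low : #|draws U r :\: H| * (r * D).+1 <= \sum_(S in draws U r :\: H) set_degree H S.
  by rewrite -sum_nat_const; apply: leq_sum => S /setDP[SU SH]; apply: ore.
rewrite (big_setID H) /= (setIidPr HU) edges in total.
have := sqr_sum_leq (degree H); rewrite sum_degree.
have := mul_bin_diag #|U| r.-1; rewrite prednK //.
move: total low q0; rewrite cq.
move: (\sum_(v in U) _) (\sum_(S in _ :\: _) _) #|H| 'C(_.-1, _) 'C(_, r) => a b h B N.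
move: #|U| => n.
move=> total low q0 nB cs.
(* Here [n * B = r * N] and, by Cauchy-Schwarz, [n * a >= (r * h) ^ 2]; hence the sum [b] over the
   non-edges satisfies [n * b <= r ^ 2 * h * (N - h)]. *)
have : (N - h) * (n * (r * D).+1) <= (N - h) * (r ^ 2 * h).
  apply: (@leq_trans (n * b)); first by rewrite mulnCA leq_mul2l low orbT.
  rewrite mulnBl leq_subRL; last first.
    rewrite leq_mul2r; apply/orP; right; lia.
  nia.
rewrite leq_mul2l subn_eq0 leqNgt -subn_gt0 q0 /= => le.
have [n0|n0] := posnP n; first by nia.
have : r * (n * D) < r * (r * h) by nia.
by rewrite ltn_pmul2l.
Qed.

(** At each vertex of [W], at most one gap of edges meets the rest of [W], so more than one gap of
    edges meets [W] in that vertex alone. Their links lie in [U :\: W] and are large enough for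
    [rainbow_matching]; adding the vertices back gives the matching. *)
Lemma matching_of_large_degrees (W : {set V}) :
  W \subset U -> r * #|W| <= #|U| ->
  (forall v, v \in W -> 2 * bin_gap #|U|.-1 r.-1 #|W|.-1 < degree H v) ->
  has_matching H #|W|.
Proof.
move=> WU rW large; have [W0|Wpos] := posnP #|W|.
  by apply: (@has_matching_leq _ _ set0); rewrite ?sub0set ?W0 ?trivIset0 //;
    apply/trivIsetP=> A B; rewrite inE.
pose v (i : 'I_#|W|) := enum_val i.
have vW i : v i \in W by apply: enum_valP.
pose E i := [set e in H | (v i \in e) && [disjoint e & W :\ v i]].
pose F i := [set e :\ v i | e in E i].
have inj i : {in E i &, injective (fun e => e :\ v i)}.
  move=> e f /setIdP[_ /andP[ve _]] /setIdP[_ /andP[vf _]] Eq.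
  by rewrite -(setD1K ve) Eq setD1K.
have [|||h [hF hD]] := @rainbow_matching V 'I_#|W| (fun=> r.-1) F (U :\: W).
- move=> i; apply/subsetP=> _ /imsetP[e /setIdP[/edgeP[eU ce] /andP[ve de]] ->].
  rewrite in_draws -ce (cardsD1 (v i) e) ve eqxx andbT subsetD.
  rewrite (subset_trans (subsetDl _ _) eU) /=.
  rewrite -(setD1K (vW i)) disjoint_sym disjoint_setU1 !inE eqxx /=.
  by rewrite disjoint_sym; apply: disjointWl de; apply: subsetDl.
- by rewrite sum_nat_const card_ord cardsD (setIidPr WU); nia.
- move=> i; rewrite card_ord (card_in_imset (inj i)) cardsD (setIidPr WU).
  have gap : #|W|.-1 * bin_pred (#|U| - #|W|) r.-1 <= bin_gap #|U|.-1 r.-1 #|W|.-1.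
    have le := subset_leq_card WU.
    by rewrite (_ : #|U| - #|W| = #|U|.-1 - #|W|.-1) ?bin_gap_ge; lia.
  have := @card_meeting V U (W :\ v i) H r (v i) r_gt0 HU (subsetP WU _ (vW i)).
  rewrite setSD // (_ : #|W :\ v i| = #|W|.-1); last by rewrite (cardsD1 (v i) W) vW.
  move=> /(_ isT); have := large _ (vW i).
  rewrite /degree -(cardsID [set e : {set V} | [disjoint e & W :\ v i]]).
  rewrite (_ : _ :&: _ = E i); last by apply/setP=> e; rewrite !inE andbA.
  set A := _ :\: _; set B := [set e in H | _ & ~~ _].
  have -> : A = B by apply/setP=> e; rewrite !inE andbC andbA.
  move=> big small; rewrite -(ltn_add2r #|B|); apply: leq_ltn_trans big.
  by rewrite mul2n -addnn leq_add.
have hH i : v i |: h i \in H.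
  case/imsetP: (hF i (in_setT i)) => e /setIdP[eH /andP[ve _]] ->.
  by rewrite setD1K.
have hW i j : v j \notin h i.
  case/imsetP: (hF i (in_setT i)) => e /setIdP[eH /andP[ve de]] ->.
  rewrite !inE; have [//|ji /=] := eqVneq (v j) (v i).
  apply: contraTN de => vj; apply/pred0Pn; exists (v j).
  by rewrite /= vj !inE ji vW.
have [||tM hinj] := @trivIimset _ _ predT (fun i => v i |: h i).
- move=> i j _ _ ij; rewrite disjoint_sym disjoint_setU1 !inE negb_or hW andbT.
  rewrite [X in _ && X]disjoint_sym disjoint_setU1 hW /= hD ?in_setT 1?eq_sym // !andbT.
  by apply: contra_neq ij => /enum_val_inj.
- by apply/negP=> /imsetP[i _ /setP/(_ (v i))]; rewrite !inE eqxx.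
apply: has_matching_leq tM _; first by apply/subsetP=> _ /imsetP[i _ ->].
by rewrite card_in_imset // card_ord.
Qed.

End Uniform.

(** * Deleting a vertex, and the induction on the matching size *)

Lemma degree_delete_leq (V : finType) (U : {set V}) (H : {set {set V}}) r u v :
  0 < r -> H \subset draws U r -> v \in U -> u \in U :\ v ->
  degree H u <= degree [set e in H | v \notin e] u + bin_gap #|U|.-1 r.-1 1.
Proof.
move=> r0 HU vU; rewrite !inE => /andP[uv uU].
have := @card_meeting V U [set v] H r u r0 HU uU.
rewrite subsetD1 sub1set vU inE uv cards1 => /(_ isT).
rewrite /degree -(cardsID [set e : {set V} | v \notin e] [set e in H | u \in e]).
move=> le; apply: leq_add.
  by apply: subset_leq_card; apply/subsetP=> e; rewrite !inE andbAC.
apply: leq_trans le; apply: subset_leq_card; apply/subsetP=> e.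
by rewrite !inE negbK disjoint_sym disjoints1 negbK => /and3P[-> -> ->].
Qed.

(** The smaller matching covers at most [r * t] vertices, none of them [v], so by [card_meeting]
    some edge at [v] misses them all. *)
Lemma matching_of_large_degree (V : finType) (U : {set V}) (H : {set {set V}}) r t v :
  0 < r -> H \subset draws U r -> v \in U ->
  bin_gap #|U|.-1 r.-1 (r * t) < degree H v ->
  has_matching [set e in H | v \notin e] t -> has_matching H t.+1.
Proof.
move=> r0 HU vU deg /has_matchingP[M [MH cM tM]].
have MH1 : M \subset H by apply: subset_trans MH _; apply/subsetP=> e /setIdP[].
have cov : cover M \subset U :\ v.
  rewrite subsetD1 (cover_sub HU MH1) /=; apply/negP=> /bigcupP[e /(subsetP MH)].
  by rewrite inE => /andP[_ /negbTE->].
have [e eH /andP[ve de]] : exists2 e, e \in H & (v \in e) && [disjoint e & cover M].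
  apply/exists_inP; apply: contraLR deg; rewrite negb_exists_in -leqNgt.
  move=> /forall_inP meet.
  have cC : #|cover M| <= r * t by rewrite -cM; exact: (card_cover_edges HU MH1).
  apply: leq_trans (leq_trans (card_meeting r0 HU vU cov) (leq_bin_gap _ _ cC)).
  apply: subset_leq_card; apply/subsetP=> e /setIdP[eH ve]; rewrite inE eH ve /=.
  by have := meet e eH; rewrite ve.
by rewrite -cM; exact: (extend_matching r0 HU MH1 tM eH de).
Qed.

(** The theorem with [t = s - 1], on a subset [U] of [V] so that deleting a vertex does not change
    the type. *)
Lemma ore_matching (V : finType) (r t : nat) (U : {set V}) (H : {set {set V}}) :
  0 < r -> H \subset draws U r -> r <= #|U| -> 3 * r ^ 2 * t <= #|U| ->
  (forall S, S \in draws U r -> S \notin H ->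
     r * bin_gap #|U|.-1 r.-1 t < set_degree H S) ->
  has_matching H t.+1.
Proof.
move=> r0; elim: t U H => [|t IH] U H HU rU nU ore.
  (* For [t = 0] one edge suffices: if [H] were empty, any [r]-subset of [U] would be a non-edge of
     degree sum 0. *)
  have [H0|[e eH]] := set_0Vmem H.
    have [S SU] := exists_draw rU.
    have := ore S SU; rewrite H0 inE => /(_ isT).
    rewrite /set_degree big1 // => v _; rewrite /degree.
    by apply/eqP; rewrite cards_eq0 -subset0; apply/subsetP=> e; rewrite !inE.
  apply: (@has_matching_leq _ _ [set e]); rewrite ?sub1set ?cards1 //.
  by apply/trivIsetP=> A B; rewrite !inE => /eqP-> /eqP->; rewrite eqxx.
apply: contraT => noM.
have nU1 : r * t.+2 <= #|U| by nia.
set D := bin_gap #|U|.-1 r.-1 t.+1 in ore.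
have deg_le v : v \in U -> degree H v <= r * D.
  move=> vU; apply: leq_trans (_ : bin_gap #|U|.-1 r.-1 (r * t.+1) <= _); last first.
    by apply: bin_gap_mul; nia.
  rewrite leqNgt; apply: contra noM => deg.
  apply: (matching_of_large_degree r0 HU vU deg).
  have cUv : #|U :\ v| = #|U|.-1 by rewrite (cardsD1 v U) vU.
  apply: (IH (U :\ v)); rewrite ?cUv.
  - apply/subsetP=> e /setIdP[/(edgeP HU)[eU ce] ve].
    by rewrite in_draws subsetD1 eU ve ce eqxx.
  - nia.
  - nia.
  move=> S; rewrite in_draws subsetD1 => /andP[/andP[SU vS] /eqP cS].
  rewrite inE vS andbT => SH.
  have := ore S; rewrite in_draws SU cS eqxx => /(_ isT SH).
  (* The threshold drops by [r] times [bin_gap #|U|.-1 r.-1 1], and each of the [r] vertices of [S]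
     loses at most one such gap. *)
  rewrite /D bin_gapS mulnDr => lt.
  rewrite -(ltn_add2r (r * bin_gap #|U|.-1 r.-1 1)); apply: leq_trans lt _.
  rewrite [r * _](_ : _ = \sum_(u in S) bin_gap #|U|.-1 r.-1 1); last first.
    by rewrite sum_nat_const cS.
  rewrite -big_split /=; apply: leq_sum => u uS.
  apply: degree_delete_leq => //; rewrite !inE (subsetP SU) // andbT.
  by apply: contraNneq vS => <-.
pose A := [set v in U | 2 * D < degree H v].
have card_A : #|A| <= t.+1.
  rewrite leqNgt; apply: contra noM => /exists_draw[W].
  rewrite in_draws => /andP[/subsetP WA /eqP cW]; rewrite -cW.
  apply: (matching_of_large_degrees r0 HU); rewrite ?cW //.
    by apply/subsetP=> v /WA/setIdP[].
  by move=> v /WA/setIdP[].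
have [|M /andP[MH tM] Mmax] :=
    @arg_maxnP _ set0 (fun M => (M \subset H) && trivIset M) (fun M => #|M|).
  by rewrite sub0set; apply/trivIsetP=> B C; rewrite inE.
have cM : #|M| <= t.+1 by rewrite leqNgt; apply: contra noM; apply: has_matching_leq.
have cC : #|cover M| <= r * t.+1.
  by apply: leq_trans (card_cover_edges HU MH) _; rewrite leq_mul2l cM orbT.
have meet e : e \in H -> ~~ [disjoint e & cover M].
  move=> eH; apply/negP=> de.
  have /has_matchingP[M' [M'H cM' tM']] := extend_matching r0 HU MH tM eH de.
  by have := Mmax M'; rewrite M'H tM' cM' /= ltnn => /(_ isT).
(* [U] has at least [r * t.+2] points, so an [r]-set fits outside the cover; it is the non-edge that
   [ore_average] requires. *)
have [|S SU] := @exists_draw _ (U :\: cover M) r.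
  by rewrite cardsD (setIidPr (cover_sub HU MH)); nia.
move: SU; rewrite in_draws subsetD => /andP[/andP[SU dS] cS].
have avg : #|U| * D < r * #|H|.
  apply: ore_average ore => //; apply/subsetPn; exists S; rewrite ?in_draws ?SU //.
  by apply: contraTN dS => /meet.
have card_H : #|H| <= \sum_(v in cover M) degree H v.
  rewrite -sum1_card.
  have -> : \sum_(v in cover M) degree H v
      = \sum_(e in H) \sum_(v in cover M | v \in e) 1.
    rewrite (exchange_big_dep (mem (cover M))) /=; last by move=> e v _ /andP[].
    apply: eq_bigr => v vC; rewrite /degree -sum1_card.
    by apply: eq_bigl => e; rewrite inE vC.
  apply: leq_sum => e /meet/pred0Pn[v /andP[/= ve vC]].
  by rewrite (bigD1 v) ?vC.
(* Each covered vertex pays [2 * D], and the at most [t.+1] of them in [A] pay a further [r * D]. *)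
have : \sum_(v in cover M) degree H v <= r * t.+1 * (2 * D) + t.+1 * (r * D).
  apply: leq_trans (_ : \sum_(v in cover M) (2 * D + (v \in A) * (r * D)) <= _).
    apply: leq_sum => v vC; have vU := subsetP (cover_sub HU MH) _ vC.
    rewrite inE vU /=; case: leqP => [le|_]; first by rewrite mul0n addn0.
    by rewrite mul1n (leq_trans (deg_le v vU)) ?leq_addl.
  rewrite big_split /= sum_nat_const leq_add ?leq_mul2r ?cC ?orbT //.
  rewrite -big_distrl leq_mul2r; apply/orP; right; apply: leq_trans card_A.
  rewrite -sum1_card [X in X <= _]big_mkcond [X in _ <= X]big_mkcond /=; apply: leq_sum => v _.
  by case: ifP; case: (v \in A).
move=> /(leq_trans card_H) small.
have : r * #|H| <= r * (r * t.+1 * (2 * D) + t.+1 * (r * D)).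
  by rewrite leq_mul2l small orbT.
have : 3 * r ^ 2 * t.+1 * D <= #|U| * D by rewrite leq_mul2r nU orbT.
by nia.
Qed.

Theorem theorem1p6 (V : finType) (H : {set {set V}}) (n r s : nat)
    (hs : 2 <= s) (hr : 1 <= r) (hn : 3 * r ^ 2 * (s - 1) <= n)
    (hV : #|V| = n) (hH : uniform r H)
    (hore : (((r * ('C(n - 1, r - 1) - 'C(n - s, r - 1)))%N%:Z)%:E
             < ore_degree r H)%E) :
  exists M : {set {set V}}, [/\ M \subset H, #|M| = s & trivIset M].
Proof.
have cV : #|[set: V]| = n by rewrite cardsT.
apply/has_matchingP; rewrite -(prednK (ltnW hs)).
apply: (@ore_matching V r s.-1 setT) => //; rewrite ?cV -?subn1 //.
- by apply/subsetP=> e eH; rewrite in_draws subsetT hH ?eqxx.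
(* From [s >= 2] and [r >= 1] follows [r <= 3 * r ^ 2 <= n]. *)
- by nia.
move=> S; rewrite in_draws subsetT /= => cS SH.
rewrite /bin_gap (_ : n - 1 - (s - 1) = n - s); last lia.
move/bigmin_gtP: hore => [_ /(_ S)]; rewrite cS SH => /(_ isT).
by rewrite lte_fin ltz_nat.
Qed.
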